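(* Let $\Omega\subset\mathbb{R}^2$ be open, $\lambda>0$, and let $u\in L^2(\Omega)$ satisfy $-\Delta u=\lambda u$ in $\Omega$. Suppose $\Gamma^+,\Gamma^-\subset\Omega$ are two singular lines of $u$ with $\Gamma^+\cap\Gamma^-=\{\mathbf{x}_0\}$, $\mathbf{x}_0\in\Omega$, forming at $\mathbf{x}_0$ the angle $\angle(\Gamma^+,\Gamma^-)=\alpha\cdot 2\pi$, where $\alpha\in(0,1)$ is irrational. Then $\mathrm{Vani}(u;\mathbf{x}_0)=0$ if $u(\mathbf{x}_0)\neq 0$, and $\mathrm{Vani}(u;\mathbf{x}_0)=+\infty$ if $u(\mathbf{x}_0)=0$. Moreover, if $u(\mathbf{x}_0)\neq0$, then in a neighborhood of $\mathbf{x}_0$ one has $u(\mathbf{x})=u(\mathbf{x}_0)J_0(\sqrt{\lambda}\,r)$ for $\mathbf{x}=\mathbf{x}_0+r(\cos\theta,\sin\theta)$, where $J_0$ is the Bessel function of the first kind of order zero.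
   Context: No boundary condition is imposed on $\partial\Omega$; $u$ is real-analytic in $\Omega$. A line segment $\Gamma\subset\Omega$ is a singular line of $u$ if $\partial_\nu u=0$ on $\Gamma$, where $\nu$ is a unit normal vector to $\Gamma$. Vanishing order: writing $u(\mathbf{x}_0+\mathbf{y})=\sum_{m\ge0}P_m(\mathbf{y})$ with $P_m$ homogeneous of degree $m$, $\mathrm{Vani}(u;\mathbf{x}_0)$ is the smallest $m$ with $P_m\not\equiv0$ ($+\infty$ if none). *)

(* Defs.v *)
From HB Require Import structures.
From mathcomp Require Import all_boot all_order all_algebra.
From mathcomp Require Import all_classical all_reals all_analysis.
Set Implicit Arguments. Unset Strict Implicit. Unset Printing Implicit Defensive.
Import Order.TTheory GRing.Theory Num.Theory.
Import numFieldNormedType.Exports.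
Local Open Scope classical_set_scope.
Local Open Scope ring_scope.

Section Defs.
Variable R : realType.

Definition leb2 := (@lebesgue_measure R \x @lebesgue_measure R)%E.

Definition L2_on (O : set (R * R)) (u : R * R -> R) : Prop :=
  leb2.-integrable O (fun x => ((u x) ^+ 2)%:E).

Definition eucl_dist (x y : R * R) : R :=
  Num.sqrt ((x.1 - y.1) ^+ 2 + (x.2 - y.2) ^+ 2).

Definition ddir (v : R * R) (u : R * R -> R) (x : R * R) : R := 'D_v u x.

Definition laplacian (u : R * R -> R) (x : R * R) : R :=
  ddir (1, 0) (ddir (1, 0) u) x + ddir (0, 1) (ddir (0, 1) u) x.

Definition hom_part (c : nat -> nat -> R) (m : nat) (y : R * R) : R :=
  \sum_(i < m.+1) c i (m - i)%N * y.1 ^+ i * y.2 ^+ (m - i).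

Definition power_expansion (u : R * R -> R) (x0 : R * R)
  (c : nat -> nat -> R) : Prop :=
  \forall y \near (0 : R * R),
    cvgn (series (fun m => \sum_(i < m.+1)
             `|c i (m - i)%N| * `|y.1| ^+ i * `|y.2| ^+ (m - i))) /\
    series (fun m => hom_part c m y) @ \oo --> u (x0 + y).

Definition real_analytic_on (O : set (R * R)) (u : R * R -> R) : Prop :=
  forall x, O x -> exists c, power_expansion u x c.

(* Vani(u; x0) = k, where k = Some n stands for n and None for +oo.
   P_m := hom_part c m for the (unique) expansion c of u at x0. *)
Definition Vani_is (u : R * R -> R) (x0 : R * R) (k : option nat) : Prop :=
  forall c, power_expansion u x0 c ->
  match k with
  | Some n => (exists y, hom_part c n y != 0) /\
              (forall m, (m < n)%N -> forall y, hom_part c m y = 0)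
  | None => forall m y, hom_part c m y = 0
  end.

Definition seg_from (x0 : R * R) (th h : R) : set (R * R) :=
  [set x | exists2 t, 0 <= t <= h & x = (x0.1 + t * cos th, x0.2 + t * sin th)].

(* Gamma is a singular line of u: the normal derivative vanishes on it;
   nu = (- sin th, cos th) is a unit normal to the segment of direction th. *)
Definition singular_line (u : R * R -> R) (G : set (R * R)) (th : R) : Prop :=
  forall x, G x -> ddir (- sin th, cos th) u x = 0.

Definition J0 (z : R) : R :=
  limn (series (fun k => (-1) ^+ k * (z / 2) ^+ (2 * k) / ((k`!)%:R ^+ 2))).

End Defs.

(* Main.v *)
Require Import Defs.
From HB Require Import structures.
From mathcomp Require Import all_boot all_order all_algebra.
From mathcomp Require Import all_classical all_reals all_analysis.
From mathcomp Require Import ring lra zify.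
Import Order.TTheory GRing.Theory Num.Theory.
Import numFieldNormedType.Exports.
Local Open Scope classical_set_scope.
Local Open Scope ring_scope.

(** Let [c] be the Taylor coefficients of [u] at [x0] and [P_m] the homogeneous
    parts.  Subtract from [c] the coefficients of [u(x0) J_0(sqrt lam r)], which
    satisfy the same Helmholtz recursion and have vanishing angular derivative.
    Inductively, if the differences vanish in degrees below [m], then in degree
    [m >= 1] the difference is a harmonic homogeneous polynomial
    [r ^ m (A cos (m phi) + B sin (m phi))].  Its angular derivative vanishes in
    both directions [thp] and [thm]; the determinant of this linear system in
    [(A, B)] is, up to a nonzero factor, [sin (m (thm - thp)) = sin (2 pi m alpha)],
    nonzero because [alpha] is irrational.  Hence the difference vanishes. *)

(** * Geometric bounds for series and a one-sided identity theorem *)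

Section Series.
Set Implicit Arguments. Unset Strict Implicit. Unset Printing Implicit Defensive.
Variable R : realType.
Implicit Types (a : nat -> R) (M K r t : R).

Lemma series_half_le a M : (forall m, `|a m| <= M / 2 ^+ m) ->
  forall n, `|series a n| <= 2 * M.
Proof.
move=> aM n.
have M0 : 0 <= M by have := aM 0%N; rewrite expr0 divr1; apply: le_trans.
(* Keeping the geometric remainder in the bound lets the induction close. *)
suff : `|series a n| <= 2 * M - 2 * M / 2 ^+ n.
  by move/le_trans; apply; rewrite gerBl divr_ge0 ?exprn_ge0 // mulr_ge0.
elim: n => [|n IHn]; first by rewrite /series /= big_geq // normr0 expr0 divr1 subrr.
rewrite seriesS; apply: (le_trans (ler_normD _ _)).
apply: (le_trans (lerD (aM n) IHn)).
have -> : 2 * M / 2 ^+ n = 2 * (M / 2 ^+ n) by rewrite mulrA.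
have -> : 2 * M / 2 ^+ n.+1 = M / 2 ^+ n.
  by rewrite exprS; field; rewrite expf_neq0.
lra.
Qed.

Lemma dist_cvgn_le (v : nat -> R) (l x B : R) : v @ \oo --> l ->
  (\forall n \near \oo, `|v n - x| <= B) -> `|l - x| <= B.
Proof.
move=> vl vB.
apply: (@ler_cvg_to nat \oo _ R (fun n => `|v n - x|) (fun=> B)) => //.
- exact: (cvg_norm (cvgB vl (cvg_cst x))).
- exact: cvg_cst.
Qed.

Lemma is_cvg_series_half a M : (forall m, `|a m| <= M / 2 ^+ m) -> cvgn (series a).
Proof.
move=> aM; apply: normed_cvg.
apply: (@series_le_cvg _ _ (geometric M 2^-1)) => [m|m|m|].
- exact: normr_ge0.
- by rewrite /= exprVn; exact: le_trans (normr_ge0 _) (aM m).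
- by rewrite /= exprVn; exact: aM.
- by apply: is_cvg_geometric_series; rewrite ger0_norm; lra.
Qed.

(** By strong induction, once the coefficients below [m] vanish, the terms beyond degree [m] sum to
    at most a constant times [t ^+ m.+1]. As the full sum is zero, dividing by [t ^+ m] gives
    [|a m| <= C * t], and [t] can be taken arbitrarily small. *)
Lemma power_series_eq0 a M K r : 0 < K -> 0 < r ->
  (forall m, `|a m| <= M * K ^+ m) ->
  (forall t, 0 <= t <= r -> series (fun m => a m * t ^+ m) @ \oo --> (0 : R)) ->
  forall m, a m = 0.
Proof.
move=> K0 r0 aM a0 m; elim/ltn_ind: m => m IHm.
have M0 : 0 <= M by have := aM 0%N; rewrite expr0 mulr1; apply: le_trans.
have bound t : 0 < t -> t <= r -> K * t <= 2^-1 ->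
    `|a m| <= 2 * M * (2 * K) ^+ m.+1 * t.
  move=> t0 tr Kt.
  (* The series with its term of index [m] deleted; by [IHm] only the indices above [m] contribute.
     There [2 * K * t <= 1] bounds [(K * t) ^+ k] by [(2 * K * t) ^+ m.+1 / 2 ^+ k]. *)
  pose b k := if k == m then 0 else a k * t ^+ k.
  have bE n : series b n =
      series (fun k => a k * t ^+ k) n - (if (m < n)%N then a m * t ^+ m else 0).
    elim: n => [|n IHn]; first by rewrite /series /= !big_geq // subr0.
    rewrite !seriesS IHn /b ltnS; case: (ltngtP n m) => [_|_|->].
    - by rewrite !subr0.
    - by rewrite addrA.
    - by rewrite add0r subr0 addrC addKr.
  have bB k : `|b k| <= (M * (2 * K * t) ^+ m.+1) / 2 ^+ k.
    have B0 : 0 <= (M * (2 * K * t) ^+ m.+1) / 2 ^+ k.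
      by rewrite divr_ge0 ?exprn_ge0 // mulr_ge0 // exprn_ge0 // !mulr_ge0 // ltW.
    rewrite /b; case: ltngtP => [km|km|_]; rewrite ?normr0 //.
      by rewrite IHm // mul0r normr0.
    rewrite normrM (ger0_norm (exprn_ge0 _ (ltW t0))).
    apply: (@le_trans _ _ (M * (K * t) ^+ k)).
      by rewrite exprMn mulrA ler_wpM2r // exprn_ge0 // ltW.
    rewrite -mulrA ler_wpM2l // ler_pdivlMr ?exprn_gt0 // -exprMn.
    have -> : K * t * 2 = 2 * K * t by ring.
    apply: ler_wiXn2l => //; first by rewrite !mulr_ge0 // ltW.
    by move: Kt; rewrite -[2^-1]mul1r ler_pdivlMr //; lra.
  have := @dist_cvgn_le _ 0 (a m * t ^+ m) _ (a0 t _) _.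
  rewrite (ltW t0) tr => /(_ (2 * (M * (2 * K * t) ^+ m.+1)) isT).
  rewrite sub0r normrN normrM (ger0_norm (exprn_ge0 _ (ltW t0))) => H.
  have {}H : `|a m| * t ^+ m <= 2 * (M * (2 * K * t) ^+ m.+1).
    apply: H; near=> n.
    have mn : (m < n)%N by near: n; exact: nbhs_infty_gt.
    by have := series_half_le bB n; rewrite bE mn.
  rewrite -(@ler_pM2r _ (t ^+ m)) ?exprn_gt0 //.
  by apply: (le_trans H); rewrite le_eqVlt exprMn [t ^+ m.+1]exprS; apply/orP; left; apply/eqP; ring.
apply/eqP; rewrite -normr_le0; apply/ler_addgt0Pr => e e0; rewrite add0r.
set C := 2 * M * (2 * K) ^+ m.+1.
have C0 : 0 <= C by rewrite /C !mulr_ge0 // exprn_ge0 // mulr_ge0 // ltW.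
(* The three entries give [t <= r], [K * t <= 2^-1] and [C * t <= e]; [C + 1] keeps the denominator
   positive when [C] is zero. *)
pose t := Num.min r (Num.min (2 * K)^-1 (e / (C + 1))).
have t0 : 0 < t by rewrite !lt_min r0 invr_gt0 mulr_gt0 // divr_gt0 // ltr_wpDl.
apply: (le_trans (bound t t0 _ _)); first by rewrite /t ge_min lexx.
  apply: (@le_trans _ _ (K * (2 * K)^-1)).
    by rewrite (ler_wpM2l (ltW K0)) // /t !ge_min lexx orbT.
  by rewrite le_eqVlt; apply/orP; left; apply/eqP; field; rewrite gt_eqF.
apply: (@le_trans _ _ (C * (e / (C + 1)))).
  by rewrite ler_wpM2l // /t !ge_min lexx !orbT.
by rewrite mulrA ler_pdivrMr ?ltr_wpDl //; nra.
Unshelve. all: by end_near.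
Qed.

End Series.

(** * Homogeneous parts, formal derivatives and first-order Taylor remainders *)

Section HomPart.
Variable R : realType.
Set Implicit Arguments. Unset Strict Implicit. Unset Printing Implicit Defensive.
Implicit Types (c : nat -> nat -> R) (v y : R * R) (M K r h : R).

Definition coef_bound c M K := forall i j, `|c i j| <= M * K ^+ (i + j).

Definition ddir_coef v c i j : R :=
  v.1 * (i.+1%:R * c i.+1 j) + v.2 * (j.+1%:R * c i j.+1).

Lemma natrS_le_exp2 m : m.+1%:R <= 2 ^+ m :> R.
Proof. by rewrite -natrX ler_nat ltn_expl. Qed.

Lemma coef_bound_ge0 c M K : coef_bound c M K -> 0 <= M.
Proof. by move/(_ 0%N 0%N); rewrite expr0 mulr1; apply: le_trans. Qed.

(** Differentiation brings in the factors [i.+1] and [j.+1], whose sum is at most [2 ^+ (i + j).+1];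
    doubling [K] absorbs it. *)
Lemma ddir_coef_bound v c M K : 0 < K -> `|v.1| <= 1 -> `|v.2| <= 1 ->
  coef_bound c M K -> coef_bound (ddir_coef v c) (2 * M * K) (2 * K).
Proof.
move=> K0 v1 v2 cM i j.
have M0 := coef_bound_ge0 cM.
have B0 : 0 <= M * K ^+ (i + j).+1 by rewrite mulr_ge0 // exprn_ge0 // ltW.
have bnd (w x : R) k : `|w| <= 1 -> `|x| <= M * K ^+ (i + j).+1 ->
    `|w * (k.+1%:R * x)| <= k.+1%:R * (M * K ^+ (i + j).+1).
  move=> w1 xB; rewrite !normrM normr_nat -[leRHS]mul1r.
  by apply: ler_pM => //; rewrite ?mulr_ge0 // ler_wpM2l.
apply: (le_trans (ler_normD _ _)).
apply: (le_trans (lerD (bnd _ _ i v1 _) (bnd _ _ j v2 _))).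
- by have := cM i.+1 j; rewrite addSn.
- by have := cM i j.+1; rewrite addnS.
rewrite -mulrDl -natrD.
apply: (@le_trans _ _ (2 ^+ (i + j).+1 * (M * K ^+ (i + j).+1))).
  rewrite ler_wpM2r //; apply: le_trans (natrS_le_exp2 _).
  by rewrite ler_nat; lia.
by rewrite le_eqVlt; apply/orP; left; apply/eqP; rewrite exprMn !exprS; ring.
Qed.

Lemma hom_part_bound c M K r m y : 0 < K -> coef_bound c M K ->
  `|y.1| <= r -> `|y.2| <= r -> `|hom_part c m y| <= m.+1%:R * (M * (K * r) ^+ m).
Proof.
move=> K0 cM y1 y2; apply: (le_trans (ler_norm_sum _ _ _)).
have -> : m.+1%:R * (M * (K * r) ^+ m) = \sum_(i < m.+1) (M * (K * r) ^+ m).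
  by rewrite sumr_const card_ord mulr_natl.
apply: ler_sum => i _; rewrite !normrM !normrX.
have im : (i + (m - i))%N = m by rewrite subnKC // -ltnS.
have -> : M * (K * r) ^+ m = (M * K ^+ m) * r ^+ i * r ^+ (m - i).
  by rewrite exprMn -{2}im exprD; ring.
apply: ler_pM; rewrite ?mulr_ge0 ?exprn_ge0 ?lerXn2r ?nnegrE ?(le_trans _ y2) //.
apply: ler_pM; rewrite ?exprn_ge0 ?lerXn2r ?nnegrE ?(le_trans _ y1) //.
by have := cM i (m - i)%N; rewrite im.
Qed.

Lemma hom_part_half c M K r m y : 0 < K -> coef_bound c M K ->
  `|y.1| <= r -> `|y.2| <= r -> K * r <= 4^-1 ->
  `|hom_part c m y| <= M / 2 ^+ m.
Proof.
move=> K0 cM y1 y2 Kr.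
have r0 : 0 <= r by apply: le_trans y1.
apply: (le_trans (hom_part_bound m K0 cM y1 y2)).
have M0 := coef_bound_ge0 cM.
apply: (@le_trans _ _ (2 ^+ m * (M * 4^-1 ^+ m))).
  have Kr0 : 0 <= K * r by rewrite mulr_ge0 // ltW.
  apply: ler_pM; rewrite ?natrS_le_exp2 ?(mulr_ge0 M0) ?exprn_ge0 //.
  by rewrite ler_wpM2l // lerXn2r ?nnegrE.
have -> : 4 = 2 * 2 :> R by ring.
rewrite exprVn exprMn le_eqVlt; apply/orP; left; apply/eqP; field.
by rewrite expf_neq0.
Qed.

(* [(2 r) ^+ n] bounds the absolute coefficient sum, at [h = r], of a product of
   [n] affine factors [a + h b] with [|a| <= r] and [|b| <= 1]. *)
Definition taylor1_bounded r h n (g0 g1 g : R) :=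
  exists2 e, g = g0 + h * g1 + h ^+ 2 * e &
    `|g0| + r * `|g1| + r ^+ 2 * `|e| <= (2 * r) ^+ n.

(** The norm with weights [1], [r], [r ^+ 2] grows by at most the factor [|a| + r * |b| <= 2 * r].
    The term of order [h ^+ 3] is kept inside the remainder, where [|h| <= r] controls it. *)
Lemma taylor1_boundedM r h n (a b g0 g1 g : R) : `|a| <= r -> `|b| <= 1 -> `|h| <= r ->
  taylor1_bounded r h n g0 g1 g ->
  taylor1_bounded r h n.+1 (a * g0) (a * g1 + b * g0) ((a + h * b) * g).
Proof.
move=> ar b1 hr [e -> eB]; exists (b * g1 + (a + h * b) * e); first by ring.
have r0 : 0 <= r by apply: le_trans ar.
apply: (@le_trans _ _ (2 * r * (`|g0| + r * `|g1| + r ^+ 2 * `|e|))); last first.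
  by rewrite [leRHS]exprS ler_wpM2l // mulr_ge0.
have -> : 2 * r * (`|g0| + r * `|g1| + r ^+ 2 * `|e|) =
   r * `|g0| + r * (r * `|g1| + 1 * `|g0|) + r ^+ 2 * (1 * `|g1| + (r + r * 1) * `|e|) by ring.
have le_r (x y z : R) : `|x| <= z -> `|x * y| <= z * `|y|.
  by move=> xz; rewrite normrM ler_wpM2r.
rewrite !lerD ?ler_wpM2l ?exprn_ge0 ?le_r //.
  by rewrite (le_trans (ler_normD _ _)) // lerD ?le_r.
rewrite (le_trans (ler_normD _ _)) // lerD ?le_r //.
by rewrite (le_trans (ler_normD _ _)) // lerD // normrM ler_pM.
Qed.

Lemma taylor1_boundedX r h n i (a b g0 g1 g : R) : `|a| <= r -> `|b| <= 1 -> `|h| <= r ->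
  taylor1_bounded r h n g0 g1 g ->
  taylor1_bounded r h (i + n) (a ^+ i * g0)
    (a ^+ i * g1 + i%:R * a ^+ i.-1 * b * g0) ((a + h * b) ^+ i * g).
Proof.
move=> ar b1 hr tg; elim: i => [|i IHi].
  by rewrite add0n !expr0 !mul1r !mul0r addr0.
have := taylor1_boundedM ar b1 hr IHi; rewrite addSn.
congr taylor1_bounded; rewrite ?exprS ?mulrA //.
case: i {IHi} => [|i]; first by rewrite !expr0; ring.
by rewrite !exprS -[i.+2%:R]natr1; ring.
Qed.

(** Reindexes the derivative by the monomials of degree [m.+1] it comes from, so that it matches the
    first-order term in [taylor1_boundedX]. *)
Lemma hom_part_ddir_coef v c m y : hom_part (ddir_coef v c) m y =
  \sum_(i < m.+2) c i (m.+1 - i)%N *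
    (y.1 ^+ i * ((m.+1 - i)%N%:R * y.2 ^+ (m.+1 - i).-1 * v.2)
     + i%:R * y.1 ^+ i.-1 * v.1 * y.2 ^+ (m.+1 - i)).
Proof.
under [RHS]eq_bigr do rewrite mulrDr.
(* The two end terms split off carry the exponent zero as a factor. *)
rewrite big_split /= [X in X + _]big_ord_recr [X in _ + X]big_ord_recl /=.
rewrite subnn !mul0r !mulr0 addr0 add0r -big_split /= /hom_part.
apply: eq_bigr => i _; rewrite /ddir_coef /bump /= add1n subSS.
have im : (i <= m)%N by rewrite -ltnS.
by rewrite subSn //=; ring.
Qed.

(** Along [y + h *: v] each monomial is a product of [m.+1] affine functions of [h], so
    [taylor1_boundedX] bounds its second-order remainder. The [m.+2] monomials cost at most
    [2 ^+ m.+1], which the powers of [2 * K * r <= 4^-1] outweigh. *)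
Lemma hom_part_taylor1 v c M K r h m y : 0 < K -> 0 < r -> coef_bound c M K ->
  `|v.1| <= 1 -> `|v.2| <= 1 -> `|y.1| <= r -> `|y.2| <= r -> `|h| <= r ->
  2 * K * r <= 4^-1 ->
  `|hom_part c m.+1 (y + h *: v) - hom_part c m.+1 y
    - h * hom_part (ddir_coef v c) m y| <= (M * h ^+ 2 / r ^+ 2) / 2 ^+ m.
Proof.
move=> K0 r0 cM v1 v2 y1 y2 hr Kr.
have M0 := coef_bound_ge0 cM.
rewrite hom_part_ddir_coef /hom_part mulr_sumr -!sumrB.
apply: (le_trans (ler_norm_sum _ _ _)).
apply: (@le_trans _ _ (\sum_(i < m.+2) (M * K ^+ m.+1) * (h ^+ 2 / r ^+ 2 * (2 * r) ^+ m.+1))).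
  apply: ler_sum => i _.
  have im : (i + (m.+1 - i))%N = m.+1 by rewrite subnKC // -ltnS.
  have t0 : taylor1_bounded r h 0 1 0 1.
    by exists 0; rewrite ?mulr0 ?addr0 // normr1 normr0 !mulr0 !addr0 expr0.
  have := taylor1_boundedX i y1 v1 hr (taylor1_boundedX (m.+1 - i) y2 v2 hr t0).
  rewrite addn0 im !mulr1 mulr0 add0r => -[e /= eE eB].
  rewrite [X in `|X|](_ : _ = c i (m.+1 - i)%N * (h ^+ 2 * e)); last first.
    by rewrite -!mulrA eE; ring.
  rewrite normrM; have := cM i (m.+1 - i)%N; rewrite im => /ler_pM; apply => //.
  rewrite normrM normrX real_normK ?num_real // -mulrA ler_wpM2l ?sqr_ge0 //.
  rewrite mulrC ler_pdivlMr ?exprn_gt0 // mulrC.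
  by apply: le_trans eB; rewrite lerDr addr_ge0 // mulr_ge0 // ltW.
rewrite sumr_const card_ord -[leLHS]mulr_natl.
have -> : M * K ^+ m.+1 * (h ^+ 2 / r ^+ 2 * (2 * r) ^+ m.+1) =
  (M * h ^+ 2 / r ^+ 2) * (2 * K * r) ^+ m.+1.
  by rewrite !exprMn; ring.
have Mhr0 : 0 <= M * h ^+ 2 / r ^+ 2 by rewrite divr_ge0 ?sqr_ge0 // mulr_ge0 // sqr_ge0.
rewrite mulrCA ler_wpM2l //.
apply: (@le_trans _ _ (2 ^+ m.+1 * 4^-1 ^+ m.+1)).
  have Kr0 : 0 <= 2 * K * r by rewrite !mulr_ge0 // ltW.
  apply: ler_pM; rewrite ?natrS_le_exp2 ?exprn_ge0 //.
  by rewrite lerXn2r ?nnegrE.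
rewrite -exprMn -exprVn.
have -> : 2 * 4^-1 = 2^-1 :> R by field.
by rewrite exprS ger_pMl ?exprn_gt0 //; lra.
Qed.

End HomPart.

(** * Local power series expansions and their termwise differentiation *)

Section Expansion.
Variable R : realType.
Set Implicit Arguments. Unset Strict Implicit. Unset Printing Implicit Defensive.
Implicit Types (c : nat -> nat -> R) (v x y : R * R) (M K r h : R) (u : R * R -> R).

Lemma near_boxP x0 (P : R * R -> Prop) : (\forall x \near x0, P x) <->
  exists2 r, 0 < r & forall y, `|y.1| <= r -> `|y.2| <= r -> P (x0 + y).
Proof.
split=> [/nbhs_ballP[e /= e0 eP]|[r r0 rP]].
  (* Halving fits the closed box inside the open ball. *)
  exists (e / 2); first by rewrite divr_gt0.
  move=> y y1 y2; apply: eP; split; rewrite /= /ball /= opprD addrA subrr sub0r normrN.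
    by apply: le_lt_trans y1 _; rewrite ltr_pdivrMr //; lra.
  by apply: le_lt_trans y2 _; rewrite ltr_pdivrMr //; lra.
apply/nbhs_ballP; exists r => //= x [x1 x2].
have -> : x = x0 + (x - x0) by rewrite addrC subrK.
by apply: rP; rewrite distrC; apply/ltW; [exact: x1|exact: x2].
Qed.

(** Working form of [power_expansion]: absolute convergence is traded for Cauchy estimates on the
    coefficients, which survive differentiation with new constants. *)
Definition expansion u x0 c := exists M K r, [/\ 0 < K, 0 < r, coef_bound c M K &
  forall y, `|y.1| <= r -> `|y.2| <= r ->
    series (fun m => hom_part c m y) @ \oo --> u (x0 + y)].

(** Absolute convergence at the corner [(r, r)] bounds its terms, and [|c i j| * r ^+ (i + j)] is
    one of the nonnegative summands of the term of index [i + j]. *)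
Lemma power_expansion_expansion u x0 c : power_expansion u x0 c -> expansion u x0 c.
Proof.
move=> /near_boxP[r r0 H].
have [M cM] : exists M, coef_bound c M r^-1.
  have rr : `|r| <= r by rewrite gtr0_norm.
  have [+ _] := H (r, r) rr rr; rewrite add0r /= => /cvg_series_bounded.
  move=> [M [_ /(_ (M + 1))]]; rewrite ltrDl ltr01 => /(_ isT) /= MB.
  exists (M + 1) => i j; have := MB (i + j)%N I => /=.
  have S0 (k : 'I_(i + j).+1) : 0 <= `|c k (i + j - k)%N| * `|r| ^+ k * `|r| ^+ (i + j - k).
    by rewrite !mulr_ge0 // exprn_ge0.
  rewrite ger0_norm ?sumr_ge0 //.
  have ij : (i < (i + j).+1)%N by rewrite ltnS leq_addr.
  rewrite (bigD1 (Ordinal ij)) //= addKn => h.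
  rewrite exprVn ler_pdivlMr ?exprn_gt0 //.
  apply: le_trans h; rewrite exprD (gtr0_norm r0) mulrA lerDl sumr_ge0 // => k _.
  by have := S0 k; rewrite (gtr0_norm r0).
exists M, r^-1, r; split; rewrite ?invr_gt0 // => y y1 y2.
by have [] := H y y1 y2; rewrite add0r.
Qed.

(** Summing the termwise Taylor remainders gives an error [C * h ^+ 2], uniform over small [h], so
    the difference quotient converges to the formal derivative. *)
Lemma expansion_ddir u x0 c v : `|v.1| <= 1 -> `|v.2| <= 1 ->
  expansion u x0 c -> expansion (ddir v u) x0 (ddir_coef v c).
Proof.
move=> v1 v2 [M [K [r [K0 r0 cM ur]]]].
(* The first entry keeps [y + h *: v] in the box of radius [r]; the second gives
   [2 * K * s <= 4^-1], as both geometric bounds require. *)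
pose s := Num.min (r / 2) (8 * K)^-1.
have s0 : 0 < s by rewrite lt_min divr_gt0 // invr_gt0 mulr_gt0.
have Ks : 2 * K * s <= 4^-1.
  apply: (@le_trans _ _ (2 * K * (8 * K)^-1)).
    by rewrite ler_wpM2l ?mulr_ge0 ?(ltW K0) // /s ge_min lexx orbT.
  by rewrite le_eqVlt; apply/orP; left; apply/eqP; field; rewrite gt_eqF.
have sr : s + s <= r.
  have : s <= r / 2 by rewrite /s ge_min lexx.
  by rewrite ler_pdivlMr // => ?; lra.
have K20 : 0 < 2 * K by rewrite mulr_gt0.
have dM := ddir_coef_bound K0 v1 v2 cM.
exists (2 * M * K), (2 * K), s; split => // y y1 y2.
have /cvg_ex[/= L dL] : cvgn (series (fun m => hom_part (ddir_coef v c) m y)).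
  apply: (@is_cvg_series_half _ _ (2 * M * K)) => m.
  exact: (hom_part_half m K20 dM y1 y2 Ks).
suff -> : ddir v u (x0 + y) = L by [].
pose C := 2 * M / s ^+ 2.
have quad h : `|h| <= s -> `|u (x0 + (y + h *: v)) - u (x0 + y) - h * L| <= C * h ^+ 2.
  move=> hs.
  have sh (w : R) : `|w| <= 1 -> `|h * w| <= s.
    by move=> w1; rewrite normrM -[leRHS]mulr1 ler_pM.
  have yr (w : R) : `|w| <= s -> `|w| <= r by move/le_trans; apply; lra.
  have cy := ur y (yr _ y1) (yr _ y2).
  have ch : series (fun m => hom_part c m (y + h *: v)) @ \oo --> u (x0 + (y + h *: v)).
    apply: ur; rewrite /=; apply: (le_trans (ler_normD _ _)); apply: le_trans sr.
      by apply: lerD => //; apply: sh.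
    by apply: lerD => //; apply: sh.
  (* Degree [m.+1] of [c] is paired with degree [m] of its derivative. The constant parts cancel,
     which explains the shift to [n.+1] in [TE]. *)
  pose T m := hom_part c m.+1 (y + h *: v) - hom_part c m.+1 y
    - h * hom_part (ddir_coef v c) m y.
  have TB m : `|T m| <= (M * h ^+ 2 / s ^+ 2) / 2 ^+ m.
    exact: (hom_part_taylor1 m K0 s0 cM v1 v2 y1 y2 hs Ks).
  have TE n : series T n = series (fun m => hom_part c m (y + h *: v)) n.+1
     - series (fun m => hom_part c m y) n.+1
     - h * series (fun m => hom_part (ddir_coef v c) m y) n.
    elim: n => [|n IHn].
      rewrite !seriesS /series /= !big_geq // /hom_part !big_ord1 /= subnn !expr0; ring.
    by rewrite seriesS IHn [in RHS]seriesS [X in _ = _ - X - _]seriesS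
      [X in _ = _ - _ - h * X]seriesS /T; ring.
  have cT : series T @ \oo --> u (x0 + (y + h *: v)) - u (x0 + y) - h * L.
    rewrite (funext TE); apply: cvgB; last by apply: cvgMr.
    by apply: cvgB; [move: ch | move: cy]; rewrite -cvg_shiftS.
  rewrite -[X in `|X|]subr0; apply: (dist_cvgn_le cT); near=> n.
  rewrite subr0; apply: (le_trans (series_half_le TB n)).
  by rewrite le_eqVlt; apply/orP; left; apply/eqP; rewrite /C; ring.
rewrite /ddir /derive; apply: cvg_lim => //.
apply/cvgrPdist_le => /= e e0.
have C0 : 0 <= C.
  by rewrite divr_ge0 ?sqr_ge0 // mulr_ge0 // (coef_bound_ge0 cM).
near=> h.
have h0 : h != 0 by near: h; exact: nbhs_dnbhs_neq.
have hs : `|h| <= s by near: h; apply: dnbhs0_le.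
have he : `|h| <= e / (C + 1).
  by near: h; apply: dnbhs0_le; rewrite divr_gt0 // ltr_wpDl.
rewrite distrC (_ : _ - L = h^-1 * (u (x0 + (y + h *: v)) - u (x0 + y) - h * L)); last first.
  by rewrite [h *: v + _]addrC -addrA mulrBr mulKf.
rewrite normrM normfV ler_pdivrMl ?normr_gt0 //.
apply: (le_trans (quad h hs)).
rewrite -real_normK ?num_real // expr2 mulrA [leRHS]mulrC ler_wpM2r //.
apply: (@le_trans _ _ (C * (e / (C + 1)))); first by rewrite ler_wpM2l.
by rewrite mulrA ler_pdivrMr ?ltr_wpDl //; nra.
Unshelve. all: by end_near.
Qed.

End Expansion.

(** * Operations on expansions, uniqueness of coefficients and the Helmholtz recursion *)

Section ExpansionAlgebra.
Variable R : realType.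
Set Implicit Arguments. Unset Strict Implicit. Unset Printing Implicit Defensive.
Implicit Types (c d : nat -> nat -> R) (v x y : R * R) (M K r h a : R) (u w : R * R -> R).

Lemma hom_partD c d m y :
  hom_part (fun i j => c i j + d i j) m y = hom_part c m y + hom_part d m y.
Proof. by rewrite /hom_part -big_split; apply: eq_bigr => i _; rewrite !mulrDl. Qed.

Lemma hom_partZl a c m y : hom_part (fun i j => a * c i j) m y = a * hom_part c m y.
Proof. by rewrite /hom_part mulr_sumr; apply: eq_bigr => i _; rewrite !mulrA. Qed.

Lemma hom_partZr a c m y : hom_part c m (a *: y) = a ^+ m * hom_part c m y.
Proof.
rewrite /hom_part mulr_sumr; apply: eq_bigr => i _.
rewrite /= -[a *: y.1]/(a * y.1) -[a *: y.2]/(a * y.2) !exprMn.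
have -> : a ^+ m = a ^+ i * a ^+ (m - i) by rewrite -exprD subnKC // -ltnS.
by ring.
Qed.

Lemma expansionD u w x0 c d : expansion u x0 c -> expansion w x0 d ->
  expansion (fun x => u x + w x) x0 (fun i j => c i j + d i j).
Proof.
move=> [M [K [r [K0 r0 cM ur]]]] [N [L [s [L0 s0 dN ws]]]].
have M0 := coef_bound_ge0 cM; have N0 := coef_bound_ge0 dN.
exists (M + N), (K + L), (Num.min r s); split.
- exact: addr_gt0.
- by rewrite lt_min r0.
- move=> i j; apply: (le_trans (ler_normD _ _)); rewrite mulrDl lerD //.
    by apply: (le_trans (cM i j)); rewrite ler_wpM2l // lerXn2r ?nnegrE ?addr_ge0 ?ltW // ltrDl.
  by apply: (le_trans (dN i j)); rewrite ler_wpM2l // lerXn2r ?nnegrE ?addr_ge0 ?ltW // ltrDr.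
move=> y; rewrite !le_min => /andP[y1 z1] /andP[y2 z2].
rewrite (_ : series _ = series (fun m => hom_part c m y) + series (fun m => hom_part d m y)).
  by apply: cvgD; [exact: ur|exact: ws].
by apply/funext => n; rewrite /series /= fctE -big_split; apply: eq_bigr => i _; rewrite hom_partD.
Qed.

Lemma expansionZ a u x0 c : expansion u x0 c ->
  expansion (fun x => a * u x) x0 (fun i j => a * c i j).
Proof.
move=> [M [K [r [K0 r0 cM ur]]]]; exists (`|a| * M), K, r; split => //.
  by move=> i j; rewrite normrM -mulrA ler_wpM2l.
move=> y y1 y2.
rewrite (_ : series _ = (fun n => a * series (fun m => hom_part c m y) n)).
  by apply: cvgMr; exact: ur.
by apply/funext => n; rewrite /series /= mulr_sumr; apply: eq_bigr => i _; rewrite hom_partZl.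
Qed.

(** Along the ray the expansion becomes a power series in [t] with coefficients [hom_part c m y], to
    which [power_series_eq0] applies. *)
Lemma expansion_ray0 w x0 c h (y : R * R) : expansion w x0 c -> 0 < h ->
  (forall t, 0 <= t <= h -> w (x0 + t *: y) = 0) -> forall m, hom_part c m y = 0.
Proof.
move=> [M [K [r [K0 r0 cM wr]]]] h0 w0.
(* [E] dominates both coordinates and stays positive when [y] is zero. *)
pose E := 1 + `|y.1| + `|y.2|.
have E0 : 0 < E by rewrite /E -addrA ltr_wpDr // addr_ge0.
have y1 : `|y.1| <= E by rewrite /E addrAC lerDr addr_ge0.
have y2 : `|y.2| <= E by rewrite /E lerDr addr_ge0.
have rh0 : 0 < Num.min h (r / E) by rewrite lt_min h0 divr_gt0.
apply: (@power_series_eq0 _ _ M (2 * (K * E)) _ _ rh0) => [|m|t].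
- by rewrite !mulr_gt0.
- apply: (le_trans (hom_part_bound m K0 cM y1 y2)).
  rewrite [in leRHS]exprMn mulrCA ler_wpM2l ?(coef_bound_ge0 cM) // ler_wpM2r ?natrS_le_exp2 //.
  by rewrite exprn_ge0 // mulr_ge0 // ltW.
rewrite le_min => /and3P[t0 th tr].
have tE (z : R) : `|z| <= E -> `|t * z| <= r.
  move=> zE; rewrite normrM (ger0_norm t0); apply: (le_trans (ler_wpM2l t0 zE)).
  by rewrite -ler_pdivlMr.
rewrite -(w0 t) ?t0 //.
have := wr (t *: y) (tE _ y1) (tE _ y2).
by under eq_fun do rewrite hom_partZr mulrC.
Qed.

Lemma expansion_near0 w x0 c : expansion w x0 c -> (\forall x \near x0, w x = 0) ->
  forall m y, hom_part c m y = 0.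
Proof.
move=> wc /near_boxP[r r0 w0] m y.
pose E := 1 + `|y.1| + `|y.2|.
have E0 : 0 < E by rewrite /E -addrA ltr_wpDr // addr_ge0.
have y1 : `|y.1| <= E by rewrite /E addrAC lerDr addr_ge0.
have y2 : `|y.2| <= E by rewrite /E lerDr addr_ge0.
apply: (@expansion_ray0 _ _ _ (r / E) _ wc); first by rewrite divr_gt0.
move=> t /andP[t0 tr].
have tE (z : R) : `|z| <= E -> `|t * z| <= r.
  move=> zE; rewrite normrM (ger0_norm t0); apply: (le_trans (ler_wpM2l t0 zE)).
  by rewrite -ler_pdivlMr.
by apply: w0; exact: tE.
Qed.

(** Setting the second variable to [1] turns the form into a polynomial of degree at most [m], which
    vanishes at the [m.+1] points [0, ..., m]. *)
Lemma hom_part_eq0_coef c m : (forall y, hom_part c m y = 0) ->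
  forall i j, (i + j)%N = m -> c i j = 0.
Proof.
move=> c0 i j ijm; pose p := \poly_(k < m.+1) c k (m - k)%N.
have pE (s : R) : p.[s] = 0.
  rewrite /p horner_poly -[RHS](c0 (s, 1)) /hom_part.
  by apply: eq_bigr => k _; rewrite /= expr1n mulr1.
have : p = 0.
  apply: (@roots_geq_poly_eq0 _ _ [seq k%:R | k <- iota 0 m.+1]).
  - by apply/allP => x _; rewrite rootE pE.
  - by rewrite map_inj_uniq ?iota_uniq //; exact: mulrIn (oner_neq0 _).
  - by rewrite size_map size_iota size_poly.
move/(congr1 (fun q : {poly R} => q`_i)).
have im : (i < m.+1)%N by lia.
by rewrite coef_poly im coef0 -ijm addKn.
Qed.

(** The function [laplacian u + lam * u] has an expansion obtained by termwise differentiation and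
    vanishes near [x0], so each of its coefficients is zero. *)
Lemma expansion_helmholtz u x0 c lam : expansion u x0 c ->
  (\forall x \near x0, - laplacian u x = lam * u x) ->
  forall i j, i.+2%:R * (i.+1%:R * c i.+2 j) + j.+2%:R * (j.+1%:R * c i j.+2) = - lam * c i j.
Proof.
move=> uc helm i j.
have n1 : `|1 : R| <= 1 by rewrite normr1.
have n0 : `|0 : R| <= 1 by rewrite normr0.
have cx := expansion_ddir (v := (1, 0)) n1 n0 (expansion_ddir (v := (1, 0)) n1 n0 uc).
have cy := expansion_ddir (v := (0, 1)) n0 n1 (expansion_ddir (v := (0, 1)) n0 n1 uc).
have := expansion_near0 (expansionD (expansionD cx cy) (expansionZ lam uc)).
move=> /(_ _)/wrap[|H].
  by apply: filterS helm => x; rewrite /laplacian => <-; rewrite subrr.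
have := hom_part_eq0_coef (H (i + j)%N) (erefl (i + j)%N).
rewrite /ddir_coef /= !(mul0r, mul1r, add0r, addr0) => {}H.
apply/eqP; rewrite mulNr -addr_eq0 -[eqbRHS]H.
by apply/eqP; ring.
Qed.

End ExpansionAlgebra.

(** * Trigonometry, harmonic forms on two rays and the Bessel coefficients *)

Section Algebra.
Variable R : realType.
Set Implicit Arguments. Unset Strict Implicit. Unset Printing Implicit Defensive.
Implicit Types (c e : nat -> nat -> R) (g : nat -> R) (y : R * R) (phi th lam : R).

Lemma sin_intMpi (k : int) : sin (k%:~R * pi) = 0 :> R.
Proof.
have nat0 (n : nat) : sin (n%:R * pi) = 0 :> R.
  elim: n => [|n IHn]; first by rewrite mul0r sin0.
  by rewrite -natr1 mulrDl mul1r sinDpi IHn oppr0.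
case: k => n; first exact: nat0.
by rewrite NegzE mulrNz mulNr sinN nat0 oppr0.
Qed.

(** Subtracting [pi] times the floor of [x / pi] leaves a number in [[0, pi)], where sine vanishes
    only at zero. *)
Lemma sin_eq0_intMpi (x : R) : sin x = 0 -> exists k : int, x = k%:~R * pi.
Proof.
move=> sx; have p0 := pi_gt0 R; exists (Num.floor (x / pi)).
have /andP[kx xk] := floor_itv (x / pi); set k := Num.floor _ in kx xk *.
apply/eqP; rewrite -subr_eq0; apply/negPn/negP => n0.
suff : 0 < sin (x - k%:~R * pi) by rewrite sinB sx sin_intMpi mul0r mulr0 subrr ltxx.
apply: sin_gt0_pi; rewrite lt_neqAle eq_sym n0 subr_ge0 -ler_pdivlMr // kx /=.
by rewrite ltrBlDr -{1}[pi]mul1r -mulrDl -ltr_pdivrMr // addrC -[1]/(1%:~R) -intrD.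
Qed.

(** De Moivre's formula in real form: [g] is the image of the powers of the imaginary unit under a
    real-linear map. The induction uses Pascal's rule and replaces [g] by its shift. *)
Lemma alternating_binomial_sum g n phi : (forall i, g i.+2 = - g i) ->
  \sum_(i < n.+1) 'C(n, i)%:R * g i * sin phi ^+ i * cos phi ^+ (n - i) =
  g 0%N * cos (n%:R * phi) + g 1%N * sin (n%:R * phi).
Proof.
elim: n g => [|n IHn] g gE.
  by rewrite big_ord1 mul0r cos0 sin0 !expr0 bin0; ring.
have -> : \sum_(i < n.+2) 'C(n.+1, i)%:R * g i * sin phi ^+ i * cos phi ^+ (n.+1 - i) =
  cos phi * (\sum_(i < n.+1) 'C(n, i)%:R * g i * sin phi ^+ i * cos phi ^+ (n - i)) +
  sin phi * (\sum_(i < n.+1) 'C(n, i)%:R * g i.+1 * sin phi ^+ i * cos phi ^+ (n - i)).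
  rewrite big_ord_recl /= [in X in _ = cos phi * X + _]big_ord_recl.
  under eq_bigr => i _ do rewrite /bump /= add1n binS natrD !mulrDl.
  rewrite big_split /= addrA; congr (_ + _); last first.
    by rewrite mulr_sumr; apply: eq_bigr => i _; rewrite subSS exprS; ring.
  rewrite big_ord_recr /= (bin_small (ltnSn n)) !mul0r addr0 mulrDr; congr (_ + _).
    by rewrite !bin0 !subn0 exprS; ring.
  rewrite mulr_sumr; apply: eq_bigr => i _; rewrite /bump /= add1n subSS.
  have -> : (n - i = (n - i.+1).+1)%N by have := ltn_ord i; lia.
  by rewrite [cos phi ^+ _.+1]exprS; ring.
rewrite (IHn g) // (IHn (fun i => g i.+1)); last by move=> i; exact: gE.
by rewrite gE -natr1 mulrDl mul1r cosD sinD; ring.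
Qed.

(** Coefficientwise vanishing of the Laplacian of the degree [m] part alone; for [m < 2] the
    condition is vacuous. *)
Definition harmonic_at e m := forall i j, (i + j).+2 = m ->
  i.+2%:R * (i.+1%:R * e i.+2 j) + j.+2%:R * (j.+1%:R * e i j.+2) = 0.

(* With [f i = i! j! e_ij], [i + j = n + 1], harmonicity reads [f (i + 2) = - f i]. *)
Lemma harmonic_normal_deriv e n th : harmonic_at e n.+1 ->
  let phi := pi / 2 - th in
  n`!%:R * hom_part (ddir_coef (- sin th, cos th) e) n (cos th, sin th) =
  n.+1`!%:R * (e 0%N n.+1) * sin (n.+1%:R * phi) - n`!%:R * e 1%N n * cos (n.+1%:R * phi).
Proof.
move=> harm phi.
pose F i := (-1) ^+ i./2 * (if odd i then n`!%:R * e 1%N n else n.+1`!%:R * e 0%N n.+1).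
have FE i : F i.+2 = - F i by rewrite /F /= negbK exprS; ring.
have fE : forall i j, (i + j)%N = n.+1 -> i`!%:R * j`!%:R * e i j = F i.
  move=> i; elim/ltn_ind: i => -[|[|i]] IH j ij.
  - have -> : j = n.+1 by lia.
    by rewrite /F /= fact0; ring.
  - have -> : j = n by lia.
    by rewrite /F /= (_ : 1`! = 1%N) //; ring.
  rewrite FE -(IH i _ j.+2) //; last by lia.
  have := harm i j (eq_trans (esym (addSn _ _)) ij).
  rewrite !factS !natrM => h; apply/eqP; rewrite -addr_eq0; apply/eqP.
  rewrite -[RHS](mulr0 (i`!%:R * j`!%:R)) -h; ring.
(* After multiplication by the factorial of [n], the coefficients of the normal derivative are
   ['C(n, i) * g i]. Passing to the complementary angle [phi] then gives the sum in
   [alternating_binomial_sum]. *)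
pose g i := - sin th * F i.+1 + cos th * F i.
have gE i : g i.+2 = - g i by rewrite /g !FE; ring.
have cE : cos th = sin phi by rewrite /phi sinB sin_pihalf cos_pihalf; ring.
have sE : sin th = cos phi by rewrite /phi cosB sin_pihalf cos_pihalf; ring.
clearbody phi.
transitivity (\sum_(i < n.+1) 'C(n, i)%:R * g i * sin phi ^+ i * cos phi ^+ (n - i)).
  rewrite /hom_part mulr_sumr; apply: eq_bigr => i _ /=; rewrite -cE -sE !mulrA.
  congr (_ * _ * _); have im : (i <= n)%N by rewrite -ltnS.
  rewrite /g -(fE i (n - i).+1); last by rewrite addnS subnKC.
  rewrite -(fE i.+1 (n - i)%N); last by rewrite addSn subnKC.
  by rewrite /ddir_coef /= -(bin_fact im) !factS !natrM; ring.
rewrite alternating_binomial_sum // /g FE /F /= !expr0 !mul1r cE sE.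
have -> : n.+1%:R * phi = n%:R * phi + phi by rewrite -natr1; ring.
by rewrite sinD cosD; ring.
Qed.

(** The rays give two linear equations for [e 0 n.+1] and [e 1 n], suitably normalized, with
    determinant the given sine up to sign. Harmonicity then propagates the zeros to all [i] in steps
    of two. *)
Lemma harmonic_two_rays e n th th' : harmonic_at e n.+1 ->
  sin (n.+1%:R * (th' - th)) != 0 ->
  hom_part (ddir_coef (- sin th, cos th) e) n (cos th, sin th) = 0 ->
  hom_part (ddir_coef (- sin th', cos th') e) n (cos th', sin th') = 0 ->
  forall i j, (i + j)%N = n.+1 -> e i j = 0.
Proof.
move=> harm snz h h'.
have := harmonic_normal_deriv th harm; have := harmonic_normal_deriv th' harm.
rewrite h h' /= mulr0.
set p := n.+1%:R * (pi / 2 - th); set p' := n.+1%:R * (pi / 2 - th').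
set a := n.+1`!%:R * e _ _; set b := n`!%:R * e _ _ => E' E.
have sE : sin (n.+1%:R * (th' - th)) = sin p * cos p' - cos p * sin p'.
  by rewrite -sinB; congr sin; rewrite /p /p'; ring.
have a0 : a = 0.
  apply: (mulIf snz); rewrite mul0r sE.
  have -> : a * (sin p * cos p' - cos p * sin p') =
    (a * sin p - b * cos p) * cos p' - (a * sin p' - b * cos p') * cos p by ring.
  by rewrite -E -E'; ring.
have b0 : b = 0.
  apply: (mulIf snz); rewrite mul0r sE.
  have -> : b * (sin p * cos p' - cos p * sin p') =
    (a * sin p - b * cos p) * sin p' - (a * sin p' - b * cos p') * sin p by ring.
  by rewrite -E -E'; ring.
have fn0 k : k`!%:R != 0 :> R by rewrite pnatr_eq0 -lt0n fact_gt0.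
move=> i; elim/ltn_ind: i => -[|[|i]] IH j ij.
- have -> : j = n.+1 by lia.
  by apply: (mulfI (fn0 n.+1)); rewrite mulr0.
- have -> : j = n by lia.
  by apply: (mulfI (fn0 n)); rewrite mulr0.
have := harm i j (eq_trans (esym (addSn _ _)) ij).
rewrite (IH i _ j.+2) //; last by lia.
by move=> /eqP; rewrite !mulr0 addr0 !mulf_eq0 !pnatr_eq0 /= => /eqP.
Qed.

(* Coefficients of [J_0 (sqrt lam * sqrt (x ^ 2 + y ^ 2))] in [x ^ i * y ^ j]. *)
Definition bessel_coef lam i j : R :=
  if odd i || odd j then 0
  else (- lam / 4) ^+ (i./2 + j./2) / ((i./2 + j./2)`! * i./2`! * j./2`!)%:R.

(** Coefficient form of the vanishing angular derivative of a radial function. *)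
Lemma bessel_coef_swap lam i j :
  i.+2%:R * bessel_coef lam i.+2 j = j.+2%:R * bessel_coef lam i j.+2.
Proof.
rewrite /bessel_coef /= !negbK; case: ifP => [_|]; first by rewrite !mulr0.
move/negbT; rewrite negb_or => /andP[oi oj].
have natS2 m : m.+2%:R = m%:R + 2 :> R by rewrite -addn2 natrD.
have natS m : m.+1%:R = m%:R + 1 :> R by rewrite natr1.
have iE : i%:R = 2 * i./2%:R :> R by rewrite -natrM mul2n even_halfK.
have jE : j%:R = 2 * j./2%:R :> R by rewrite -natrM mul2n even_halfK.
rewrite addSn addnS !factS !natrM (natS2 i) (natS2 j) iE jE.
rewrite (natS i./2) (natS j./2) (natS (i./2 + j./2)%N).
move: (i./2) (j./2) => k l.
have fn0 m : m`!%:R != 0 :> R by rewrite pnatr_eq0 -lt0n fact_gt0.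
have n0 m : m%:R + 1 != 0 :> R by rewrite natr1 pnatr_eq0.
by field; rewrite !fn0 !n0 -natrD n0.
Qed.

(** By [bessel_coef_swap] both terms become multiples of [bessel_coef lam i j.+2], with total factor
    [(i + j).+2 * j.+2]. *)
Lemma bessel_coef_helmholtz lam i j :
  i.+2%:R * (i.+1%:R * bessel_coef lam i.+2 j) +
  j.+2%:R * (j.+1%:R * bessel_coef lam i j.+2) = - lam * bessel_coef lam i j.
Proof.
rewrite mulrCA bessel_coef_swap [X in _ + X]mulrCA -mulrDl.
rewrite /bessel_coef /= negbK; case: ifP => [_|]; first by rewrite !mulr0.
move/negbT; rewrite negb_or => /andP[oi oj].
have natS2 m : m.+2%:R = m%:R + 2 :> R by rewrite -addn2 natrD.
have natS m : m.+1%:R = m%:R + 1 :> R by rewrite natr1.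
have iE : i%:R = 2 * i./2%:R :> R by rewrite -natrM mul2n even_halfK.
have jE : j%:R = 2 * j./2%:R :> R by rewrite -natrM mul2n even_halfK.
rewrite addnS !factS !natrM (natS2 j) (natS i) (natS j) iE jE.
rewrite (natS j./2) (natS (i./2 + j./2)%N) exprS natrD.
move: (i./2) (j./2) => k l.
have fn0 m : m`!%:R != 0 :> R by rewrite pnatr_eq0 -lt0n fact_gt0.
have n0 m : m%:R + 1 != 0 :> R by rewrite natr1 pnatr_eq0.
by field; rewrite !fn0 !n0 -natrD n0.
Qed.

Lemma bessel_normal_deriv lam n th :
  hom_part (ddir_coef (- sin th, cos th) (bessel_coef lam)) n (cos th, sin th) = 0.
Proof.
pose d := bessel_coef lam; pose x := cos th; pose s := sin th.
have -> : hom_part (ddir_coef (- s, x) d) n (x, s) =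
    (\sum_(i < n.+1) (n - i).+1%:R * d i (n - i).+1 * x ^+ i.+1 * s ^+ (n - i)) -
    (\sum_(i < n.+1) i.+1%:R * d i.+1 (n - i)%N * x ^+ i * s ^+ (n - i).+1).
  by rewrite -sumrB; apply: eq_bigr => i _; rewrite /ddir_coef /= !exprS; ring.
apply/eqP; rewrite subr_eq0; apply/eqP.
(* The unmatched end terms have an index equal to [1], hence a zero coefficient; the others pair up
   by [bessel_coef_swap]. *)
rewrite big_ord_recr [RHS]big_ord_recl /= subnn {2 4}/d /bessel_coef /= orbT.
rewrite !(mulr0, mul0r) addr0 add0r; apply: eq_bigr => i _; rewrite /bump /= add1n.
have -> : (n - i = (n - i.+1).+1)%N by have := ltn_ord i; lia.
by rewrite -/d -bessel_coef_swap.
Qed.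

Lemma sum_even_ord (G : nat -> R) k : (forall i, odd i -> G i = 0) ->
  \sum_(i < k.*2.+1) G i = \sum_(l < k.+1) G l.*2.
Proof.
move=> G0; elim: k => [|k IHk]; first by rewrite !big_ord1.
rewrite doubleS big_ord_recr big_ord_recr /= IHk [RHS]big_ord_recr /= G0 ?addr0 //=.
by rewrite odd_double.
Qed.

Lemma hom_part_bessel_odd lam m y : odd m -> hom_part (bessel_coef lam) m y = 0.
Proof.
move=> om; rewrite /hom_part big1 // => i _.
have im : (i <= m)%N by rewrite -ltnS.
by rewrite /bessel_coef oddB // om /=; case: odd; rewrite !mul0r.
Qed.

(** The binomial theorem for [(y.1 ^+ 2 + y.2 ^+ 2) ^+ k]; it identifies the double series with that
    of [J0]. *)
Lemma hom_part_bessel_even lam k y : hom_part (bessel_coef lam) k.*2 y =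
  (- lam / 4) ^+ k * (y.1 ^+ 2 + y.2 ^+ 2) ^+ k / k`!%:R ^+ 2.
Proof.
pose G i := bessel_coef lam i (k.*2 - i)%N * y.1 ^+ i * y.2 ^+ (k.*2 - i).
rewrite /hom_part (@sum_even_ord G k); last first.
  by move=> i oi; rewrite /G /bessel_coef oi !mul0r.
rewrite addrC exprDn mulr_sumr mulr_suml; apply: eq_bigr => l _; rewrite /G.
have lk : (l <= k)%N by rewrite -ltnS.
rewrite -doubleB /bessel_coef !odd_double /= !doubleK subnKC //.
rewrite -!exprM !mul2n -mulr_natl.
have fn0 m : m`!%:R != 0 :> R by rewrite pnatr_eq0 -lt0n fact_gt0.
rewrite -(bin_fact lk) !natrM.
have b0 : 'C(k, l)%:R != 0 :> R by rewrite pnatr_eq0 -lt0n bin_gt0.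
by field; rewrite ?fn0 ?b0.
Qed.

Lemma normal_helmholtz_coef c lam th th' :
  (forall i j, i.+2%:R * (i.+1%:R * c i.+2 j) + j.+2%:R * (j.+1%:R * c i j.+2) = - lam * c i j) ->
  (forall n, sin (n.+1%:R * (th' - th)) != 0) ->
  (forall n, hom_part (ddir_coef (- sin th, cos th) c) n (cos th, sin th) = 0) ->
  (forall n, hom_part (ddir_coef (- sin th', cos th') c) n (cos th', sin th') = 0) ->
  forall i j, c i j = c 0%N 0%N * bessel_coef lam i j.
Proof.
move=> ch snz hth hth' i j.
pose e i j := c i j - c 0%N 0%N * bessel_coef lam i j.
suff e0 : forall m i j, (i + j)%N = m -> e i j = 0.
  by apply/eqP; rewrite -subr_eq0; apply/eqP; exact: e0 (erefl _).
have nE n t : hom_part (ddir_coef (- sin t, cos t) c) n (cos t, sin t) = 0 ->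
    hom_part (ddir_coef (- sin t, cos t) e) n (cos t, sin t) = 0.
  move=> hc; rewrite -[RHS](subr0 (0 : R)) -{1}hc -(mulr0 (c 0%N 0%N)) -(bessel_normal_deriv lam n t).
  by rewrite /hom_part mulr_sumr -sumrB; apply: eq_bigr => k _; rewrite /ddir_coef /e /=; ring.
elim/ltn_ind => -[|n] IH.
  move=> {}i {}j /eqP; rewrite addn_eq0 => /andP[/eqP-> /eqP->].
  by rewrite /e /bessel_coef /= expr0 fact0; field.
(* The Laplacian of the degree [n.+1] part of [e] is [- lam] times the part two degrees lower, which
   is zero by induction. *)
apply: (harmonic_two_rays _ (snz n) (nE _ _ (hth n)) (nE _ _ (hth' n))) => k l kl.
have ekl : e k l = 0 by apply: (IH (k + l)%N) => //; lia.
transitivity (- lam * e k l); last by rewrite ekl mulr0.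
have -> : - lam * e k l = - lam * c k l - c 0%N 0%N * (- lam * bessel_coef lam k l).
  by rewrite /e; ring.
by rewrite -ch -bessel_coef_helmholtz /e; ring.
Qed.

End Algebra.

(** * Singular lines, irrational angles and the Bessel representation *)

Section Conclusion.
Variable R : realType.
Set Implicit Arguments. Unset Strict Implicit. Unset Printing Implicit Defensive.
Implicit Types (c : nat -> nat -> R) (u : R * R -> R).

Lemma expansion_at_center u x0 c : expansion u x0 c -> u x0 = c 0%N 0%N.
Proof.
move=> [M [K [r [K0 r0 cM ur]]]].
have := ur 0; rewrite /= normr0 addr0 => /(_ (ltW r0) (ltW r0)) cu.
have hE n : series (fun m => hom_part c m 0) n.+1 = c 0%N 0%N.
  elim: n => [|n IHn]; rewrite seriesS.
    by rewrite /series /= big_geq // addr0 /hom_part big_ord1 subnn !expr0 !mulr1.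
  by rewrite IHn -[X in hom_part _ _ X](scale0r 0) hom_partZr exprS !mul0r add0r.
have c0 : (fun n => series (fun m => hom_part c m 0) n.+1) @ \oo --> u x0.
  by move: cu; rewrite -cvg_shiftS.
rewrite (funext hE) in c0.
by apply: (cvg_unique _ c0 (cvg_cst _)).
Qed.

(** The normal derivative has the differentiated expansion and vanishes along a ray from [x0], so
    [expansion_ray0] applies degree by degree. *)
Lemma expansion_singular_line u x0 c th h : expansion u x0 c -> 0 < h ->
  singular_line u (seg_from x0 th h) th ->
  forall n, hom_part (ddir_coef (- sin th, cos th) c) n (cos th, sin th) = 0.
Proof.
move=> uc h0 sl.
have n1 : `|- sin th| <= 1 by rewrite normrN sin_max.
have := expansion_ddir (v := (- sin th, cos th)) n1 (cos_max th) uc.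
move=> /expansion_ray0; apply; first exact: h0.
by move=> t t0h; apply: sl; exists t.
Qed.

(** A zero of the sine would make [2 * n.+1 * alpha] an integer. *)
Lemma irrational_angle_sin_neq0 (alpha : R) (n : nat) :
  (forall p q : int, q != 0 -> alpha != p%:~R / q%:~R) ->
  sin (n.+1%:R * (alpha * (2 * pi))) != 0.
Proof.
move=> irr; apply/eqP => /sin_eq0_intMpi[k kE].
have /negP := irr k (2 * n.+1)%N%:Z isT; apply.
rewrite -pmulrn natrM eq_sym; apply/eqP.
have n0 : n.+1%:R != 0 :> R by rewrite pnatr_eq0.
have p0 : pi != 0 :> R by rewrite gt_eqF // pi_gt0.
apply: (mulIf p0); rewrite mulrAC -kE.
by field.
Qed.

Lemma bessel_expansion u x0 c lam : 0 <= lam -> expansion u x0 c ->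
  (forall i j, c i j = u x0 * bessel_coef lam i j) -> u x0 != 0 ->
  \forall x \near x0, u x = u x0 * J0 (Num.sqrt lam * eucl_dist x x0).
Proof.
move=> lam0 [M [K [r [K0 r0 _ ur]]]] cE u0.
apply/near_boxP; exists r => // y y1 y2.
set z := Num.sqrt lam * _.
have z2 : z ^+ 2 = lam * (y.1 ^+ 2 + y.2 ^+ 2).
  rewrite /z exprMn !sqr_sqrtr ?addr_ge0 ?sqr_ge0 //=.
  by congr (_ * (_ ^+ 2 + _ ^+ 2)); ring.
set T := fun k => (-1) ^+ k * (z / 2) ^+ (2 * k) / (k`!)%:R ^+ 2.
have homE m : hom_part c m y = u x0 * hom_part (bessel_coef lam) m y.
  by rewrite -hom_partZl; apply: eq_bigr => i _; rewrite cE.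
have TE k : hom_part (bessel_coef lam) k.*2 y = T k.
  rewrite hom_part_bessel_even /T exprM -!exprMn; congr (_ ^+ _ / _).
  by rewrite exprMn z2; field.
(* Odd degrees vanish, so the first [n.*2] homogeneous parts give exactly [n] terms of the Bessel
   series. *)
have sE n : series (fun m => hom_part c m y) n.*2 = u x0 * series T n.
  elim: n => [|n IHn]; first by rewrite /series /= !big_geq // mulr0.
  rewrite doubleS !seriesS IHn !homE TE hom_part_bessel_odd ?oddS ?odd_double //.
  by ring.
have dbl : (fun n => n.*2) @ \oo --> \oo.
  move=> A [N _ NA]; exists N => // n /= Nn; apply: NA => /=.
  by rewrite -addnn (leq_trans Nn) // leq_addr.
have := cvg_comp _ _ dbl (ur y y1 y2).
rewrite (_ : _ \o _ = (fun n => u x0 * series T n)); last exact/funext.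
(* Dividing by [u x0] yields convergence of the series of [J0] itself, so that [limn] is its genuine
   limit. *)
move=> /(cvgMr (a := (u x0)^-1)).
rewrite (_ : (fun n => _) = series T); last by apply/funext => n; rewrite mulKf.
by move=> cT; rewrite /J0 (cvg_lim _ cT) // mulVKf.
Qed.

End Conclusion.

Theorem theorem2p4 (R : realType) (Omega : set (R * R)) (lam : R)
  (u : R * R -> R) (x0 : R * R) (thp thm hp hm alpha : R) :
  open Omega ->
  0 < lam ->
  L2_on Omega u ->
  real_analytic_on Omega u ->
  (forall x, Omega x -> - laplacian u x = lam * u x) ->
  Omega x0 ->
  0 < hp -> 0 < hm ->
  seg_from x0 thp hp `<=` Omega ->
  seg_from x0 thm hm `<=` Omega ->
  singular_line u (seg_from x0 thp hp) thp ->
  singular_line u (seg_from x0 thm hm) thm ->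
  seg_from x0 thp hp `&` seg_from x0 thm hm = [set x0] ->
  0 < alpha < 1 ->
  (forall p q : int, q != 0 -> alpha != p%:~R / q%:~R) ->
  thm = thp + alpha * (2 * pi) ->
  (u x0 != 0 -> Vani_is u x0 (Some 0%N)) /\
  (u x0 = 0 -> Vani_is u x0 None) /\
  (u x0 != 0 -> \forall x \near x0,
      u x = u x0 * J0 (Num.sqrt lam * eucl_dist x x0)).
Proof.
move=> oO lam0 _ ua helm Ox0 hp0 hm0 _ _ slp slm _ _ irr thE.
(* All three conclusions are read off from this identification of the coefficients. *)
have cE c : power_expansion u x0 c -> forall i j, c i j = u x0 * bessel_coef lam i j.
  move=> /power_expansion_expansion uc; rewrite (expansion_at_center uc).
  apply: (@normal_helmholtz_coef _ c lam thp thm).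
  - apply: (expansion_helmholtz uc); near=> x; apply: helm.
    by near: x; exact: open_nbhs_nbhs.
  - move=> n; have -> : thm - thp = alpha * (2 * pi) by rewrite thE addrC addKr.
    exact: irrational_angle_sin_neq0.
  - exact: (expansion_singular_line uc hp0 slp).
  - exact: (expansion_singular_line uc hm0 slm).
split; [|split].
(* The degree zero part is the constant [u x0], so the origin serves as witness. *)
- move=> u0 c uc; split => //; exists 0.
  rewrite /hom_part big_ord1 subnn !expr0 !mulr1.
  by rewrite -(expansion_at_center (power_expansion_expansion uc)).
- move=> u0 c uc m y; rewrite /hom_part big1 // => i _.
  by rewrite (cE c uc) u0 !mul0r.
- move=> u0; have [c uc] := ua _ Ox0.
  exact: (bessel_expansion (ltW lam0) (power_expansion_expansion uc) (cE c uc) u0).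
Unshelve. all: by end_near.
Qed.
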